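(* All inverse semigroup actions $(S,X,\alpha)$ (as objects) and all action morphisms $(\theta,\xi)$ (as morphisms) form a category, with composition $(\theta_2,\xi_2)\cdot(\theta_1,\xi_1):=(\theta_2\circ\theta_1,\ \xi_1\circ\xi_2)$ and with identity morphism $(\mathrm{id}_S,\mathrm{id}_X)$ for each $(S,X,\alpha)$.
   Context: Partial maps: for topological spaces $X,Y$, a partial map $f\colon X\supset D_f\to Y$ is a continuous map from an open subspace $D_f\subset X$ (its domain) to $Y$. For $V\subset Y$, $f^{-1}(V):=\{x\in D_f: f(x)\in V\}$. The composition of $f_1\colon X\supset D_{f_1}\to Y$ and $f_2\colon Y\supset D_{f_2}\to Z$ is $f_2\circ f_1\colon X\supset f_1^{-1}(D_{f_2})\to Z$, $x\mapsto f_2(f_1(x))$. An inverse semigroup is a semigroup $S$ in which every $s$ has a unique $s^*$ with $ss^*s=s$, $s^*ss^*=s^*$. Semigroup homomorphisms are the multiplicative maps. $I(X)$ is the inverse semigroup of all homeomorphisms between open subspaces of $X$, under composition of partial maps. An inverse semigroup action $(S,X,\alpha)$ consists of an inverse semigroup $S$, a topological space $X$ and a semigroup homomorphism $\alpha\colon S\to I(X)$, $s\mapsto\alpha_s$, such that $\bigcup_{s\in S}D^\alpha_s=X$, where $D^\alpha_s$ is the domain of $\alpha_s$. An action morphism $(\theta,\xi)\colon(S,X,\alpha)\to(T,Y,\beta)$ consists of a semigroup homomorphism $\theta\colon S\to T$ and a partial map $\xi\colon Y\supset D_\xi\to X$ such that (i) $\xi^{-1}(D^\alpha_s)=D^\beta_{\theta(s)}$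 for every $s\in S$; (ii) $\alpha_s(\xi(y))=\xi(\beta_{\theta(s)}(y))$ for every $s\in S$ and $y\in\xi^{-1}(D^\alpha_s)$. *)

(* Defs.v *)
From HB Require Import structures.
From mathcomp Require Import all_boot monoid.
From mathcomp Require Import all_classical topology.

Set Implicit Arguments.
Unset Strict Implicit.
Unset Printing Implicit Defensive.

Local Open Scope classical_set_scope.

Definition odom (A B : Type) (f : A -> option B) : set A := [set x | f x].

(* A partial map is encoded as an option-valued function, [f x = None] meaning
   that [x] is outside the domain, so that equality of partial maps is equality
   of domains and of values.  Continuity is that of the map induced on the
   domain with its subspace topology. *)
Record pmap (X Y : topologicalType) := PMap {
  pmap_fun :> X -> option Y;
  pmap_open : open (odom pmap_fun);
  pmap_continuous : exists2 g : set_type (odom pmap_fun) -> Y,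
    continuous g & forall u, pmap_fun (set_val u) = Some (g u) }.

Definition ppreimage (X Y : topologicalType) (f : pmap X Y) (V : set Y) :
  set X := [set x | exists2 y, f x = Some y & V y].

Lemma pmapP (X Y : topologicalType) (f g : pmap X Y) :
  (forall x, f x = g x) -> f = g.
Proof.
case: f g => [f fo fc] [g go gc] /= /funext fg.
by case: g / fg in go gc *; congr PMap; exact: Prop_irrelevance.
Qed.

Lemma open_ppreimage (X Y : topologicalType) (f : pmap X Y) (V : set Y) :
  open V -> open (ppreimage f V).
Proof.
move=> oV; case: (pmap_continuous f) => g /continuousP/(_ V oV)[W oW gW] fg.
suff -> : ppreimage f V = W `&` odom f by exact: openI oW (pmap_open f).
have gWE (u : set_type (odom f)) : W (set_val u) <-> V (g u).
  by rewrite -[V (g u)]/((g @^-1` V) u) -gW.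
apply/seteqP; split => [x [y fx Vy]|x [Wx Dx]].
- have Dx : odom f x by rewrite /odom /= fx.
  split=> //; apply/(gWE (SigSub (mem_set Dx))).
  have := fg (SigSub (mem_set Dx)).
  by rewrite set_valE /= fx => -[<-].
- have := fg (SigSub (mem_set Dx)); rewrite set_valE /= => fx.
  by exists (g (SigSub (mem_set Dx))) => //; apply/gWE.
Qed.

Lemma ocontinuousP (X Y : topologicalType) (f : X -> option Y) :
  (forall V, open V -> open [set x | exists2 y, f x = Some y & V y]) ->
  exists2 g : set_type (odom f) -> Y,
    continuous g & forall u, f (set_val u) = Some (g u).
Proof.
move=> fo.
have /choice[g fg] : forall u : set_type (odom f),
    exists y, f (set_val u) = Some y.
  move=> [x /= xD]; have := set_mem xD; rewrite /odom /= set_valE /=.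
  by case: (f x) => // y _; exists y.
exists g => //; apply/continuousP => V oV.
exists [set x | exists2 y, f x = Some y & V y]; first exact: fo.
apply/seteqP; split => [u [y]|u Vgu] /=; first by rewrite fg => -[<-].
by exists (g u).
Qed.

Section Id.
Variable X : topologicalType.

Let id_open : open (odom (@Some X)).
Proof.
suff -> : odom (@Some X) = setT by exact: openT.
by apply/seteqP; split.
Qed.

Let id_continuous : exists2 g : set_type (odom (@Some X)) -> X,
  continuous g & forall u, Some (set_val u) = Some (g u).
Proof. by exists set_val => //; exact: initial_continuous. Qed.

Definition pmap_id : pmap X X := PMap id_open id_continuous.

End Id.

Section Comp.
Variables X Y Z : topologicalType.
Variables (f2 : pmap Y Z) (f1 : pmap X Y).

Let comp_ppreimage V : [set x | exists2 z, pcomp f2 f1 x = Some z & V z] =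
  ppreimage f1 (ppreimage f2 V).
Proof.
apply/seteqP; split => [x [z]|x [y fx [z fy Vz]]] /=.
- rewrite /pcomp; case fx: (f1 x) => [y|] //= fy Vz.
  by exists y => //; exists z.
- by exists z => //; rewrite /pcomp fx.
Qed.

Let comp_open : open (odom (pcomp f2 f1)).
Proof.
suff -> : odom (pcomp f2 f1) = [set x | exists2 z, pcomp f2 f1 x = Some z & setT z].
  by rewrite comp_ppreimage; do 2!apply: open_ppreimage; exact: openT.
apply/seteqP; split => [x|x [z]]; rewrite /odom /=; last by move=> ->.
by case: (pcomp f2 f1 x) => // z _; exists z.
Qed.

Let comp_continuous : exists2 g : set_type (odom (pcomp f2 f1)) -> Z,
  continuous g & forall u, pcomp f2 f1 (set_val u) = Some (g u).
Proof.
apply: ocontinuousP => V oV; rewrite comp_ppreimage.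
by do 2!apply: open_ppreimage.
Qed.

(* [pmap_comp f2 f1] is x |-> f2 (f1 x), with domain the f1-preimage of the
   domain of f2. *)
Definition pmap_comp : pmap X Z := PMap comp_open comp_continuous.

End Comp.

(* Homeomorphisms between open subspaces of [X]: partial maps of [X] inverted
   by a partial map whose domain is the image. *)
Record phomeo (X : topologicalType) := PHomeo {
  phomeo_map :> pmap X X;
  phomeo_inv : exists g : pmap X X,
    forall x y, phomeo_map x = Some y <-> g y = Some x }.

Section PHomeoSemigroup.
Variable X : topologicalType.
Implicit Types f g h : phomeo X.

Lemma phomeoP f g : (forall x, f x = g x) -> f = g.
Proof.
case: f g => [f fi] [g gi] /= /pmapP fg.
by case: g / fg in gi *; congr PHomeo; exact: Prop_irrelevance.
Qed.

Let comp_inv f g : exists h : pmap X X,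
  forall x y, pmap_comp f g x = Some y <-> h y = Some x.
Proof.
case: (phomeo_inv f) (phomeo_inv g) => [f' ff'] [g' gg'].
exists (pmap_comp g' f') => x z; rewrite /= /pcomp; split.
- by case gx: (g x) => [y|] //= /ff' ->; apply/gg'.
- by case fz: (f' z) => [y|] //= /gg' ->; apply/ff'.
Qed.

Definition phomeo_mul f g : phomeo X := PHomeo (comp_inv f g).

Let phomeo_mulA : associative phomeo_mul.
Proof.
by move=> f g h; apply: phomeoP => x; rewrite /= /pcomp /=; case: (h x).
Qed.

HB.instance Definition _ := gen_eqMixin (phomeo X).
HB.instance Definition _ := gen_choiceMixin (phomeo X).
HB.instance Definition _ := isSemigroup.Build (phomeo X) phomeo_mulA.

End PHomeoSemigroup.

Definition inverse_semigroup (S : semigroupType) : Prop :=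
  forall s : S, exists! t : S, (s * t * s = s /\ t * s * t = t)%g.

Record inv_action := InvAction {
  act_sgrp : semigroupType;
  act_sgrp_inverse : inverse_semigroup act_sgrp;
  act_space : topologicalType;
  act_hom : {multiplicative act_sgrp -> phomeo act_space};
  act_cover : \bigcup_s odom (act_hom s) = setT }.

Record action_morphism (A B : inv_action) := ActionMorphism {
  mor_sgrp : {multiplicative act_sgrp A -> act_sgrp B};
  mor_map : pmap (act_space B) (act_space A);
  mor_dom : forall s : act_sgrp A,
    ppreimage mor_map (odom (act_hom A s)) = odom (act_hom B (mor_sgrp s));
  mor_equivariant : forall (s : act_sgrp A) (y : act_space B),
    ppreimage mor_map (odom (act_hom A s)) y ->
    obind (act_hom A s) (mor_map y) = obind mor_map (act_hom B (mor_sgrp s) y) }.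

Record category_on (Ob : Type) (Hom : Ob -> Ob -> Type) := CategoryOn {
  cat_id : forall A, Hom A A;
  cat_comp : forall A B C, Hom B C -> Hom A B -> Hom A C;
  cat_comp1m : forall A B (f : Hom A B), cat_comp (cat_id B) f = f;
  cat_compm1 : forall A B (f : Hom A B), cat_comp f (cat_id A) = f;
  cat_compA : forall A B C D (h : Hom C D) (g : Hom B C) (f : Hom A B),
    cat_comp h (cat_comp g f) = cat_comp (cat_comp h g) f }.

(* Main.v *)
Require Import Defs.
From HB Require Import structures.
From mathcomp Require Import all_boot monoid.
From mathcomp Require Import all_classical topology.

(** Morphisms run against their space maps: [mor_map] goes from the space of
    the target to that of the source, so composites are formed in the opposite
    order.  The condition on domains survives composition because preimages
    under a composite of partial maps are iterated preimages.  Equivariance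
    survives by pasting two commuting squares: if [xi1 (xi2 z)] lies in the
    domain of [s], the condition on domains for the first morphism places
    [xi2 z] in the domain of [theta1 s], which is exactly where the second
    square is known to commute.  The category laws then reduce to those of
    functions and of partial maps, since a morphism is determined by its two
    underlying maps. *)

Set Implicit Arguments.
Unset Strict Implicit.
Unset Printing Implicit Defensive.

Local Open Scope classical_set_scope.

Lemma ppreimage_comp (X Y Z : topologicalType) (f2 : Defs.pmap Y Z) (f1 : Defs.pmap X Y)
    (V : set Z) :
  ppreimage (pmap_comp f2 f1) V = ppreimage f1 (ppreimage f2 V).
Proof.
apply/seteqP; split => [x [z]|x [y fx [z fy Vz]]] /=.
- rewrite /pcomp; case fx: (f1 x) => [y|] //= fy Vz.
  by exists y => //; exists z.
- by exists z => //; rewrite /= /pcomp fx.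
Qed.

(** Multiplicativity is a proposition, so proof irrelevance leaves only the
    underlying functions to compare. *)
Lemma multiplicativeP (S T : semigroupType) (f g : {multiplicative S -> T}) :
  (f : S -> T) = g -> f = g.
Proof.
case: f g => [f [[fM]]] [g [[gM]]] /= fg.
by case: g / fg in gM *; rewrite (Prop_irrelevance fM gM).
Qed.

Lemma action_morphismP (A B : inv_action) (f g : action_morphism A B) :
  (mor_sgrp f : act_sgrp A -> act_sgrp B) = mor_sgrp g ->
  (forall y, mor_map f y = mor_map g y) -> f = g.
Proof.
case: f g => [f p fd fe] [g q gd ge] /= /multiplicativeP fg /pmapP pq.
case: g / fg in gd ge *; case: q / pq in gd ge *.
by rewrite (Prop_irrelevance fd gd) (Prop_irrelevance fe ge).
Qed.

Section Identity.
Variable A : inv_action.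

Let id_dom (s : act_sgrp A) :
  ppreimage (pmap_id (act_space A)) (odom (act_hom A s)) =
  odom (act_hom A (idfun s)).
Proof. by apply/seteqP; split => [x [_ [<-]]|x Dx] //; exists x. Qed.

Let id_equivariant (s : act_sgrp A) (y : act_space A) :
  ppreimage (pmap_id (act_space A)) (odom (act_hom A s)) y ->
  obind (act_hom A s) (pmap_id (act_space A) y) =
  obind (pmap_id (act_space A)) (act_hom A (idfun s) y).
Proof. by rewrite /=; case: (act_hom A s y). Qed.

Definition mor_id : action_morphism A A :=
  @ActionMorphism A A idfun (pmap_id (act_space A)) id_dom id_equivariant.

End Identity.

Section Composition.
Variables (A B C : inv_action).
Variables (m2 : action_morphism B C) (m1 : action_morphism A B).

Let theta : act_sgrp A -> act_sgrp C := mor_sgrp m2 \o mor_sgrp m1.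
Let xi : Defs.pmap (act_space C) (act_space A) :=
  pmap_comp (mor_map m1) (mor_map m2).

Let comp_dom (s : act_sgrp A) :
  ppreimage xi (odom (act_hom A s)) = odom (act_hom C (theta s)).
Proof. by rewrite ppreimage_comp !mor_dom. Qed.

Let comp_equivariant (s : act_sgrp A) (z : act_space C) :
  ppreimage xi (odom (act_hom A s)) z ->
  obind (act_hom A s) (xi z) = obind xi (act_hom C (theta s) z).
Proof.
rewrite ppreimage_comp => Dz.
(* The domain condition of [m1] turns [Dz] into the hypothesis under which [m2]
   is equivariant at [mor_sgrp m1 s]. *)
have := Dz; rewrite mor_dom => /mor_equivariant; rewrite -/(theta s).
case: Dz => y xi2z /mor_equivariant sq1.
rewrite /= /pcomp xi2z /= sq1 => ->.
by case: (act_hom C (theta s) z).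
Qed.

Definition mor_comp : action_morphism A C :=
  @ActionMorphism A C (mor_sgrp m2 \o mor_sgrp m1) xi comp_dom comp_equivariant.

End Composition.

Lemma mor_comp1m (A B : inv_action) (f : action_morphism A B) :
  mor_comp (mor_id B) f = f.
Proof. exact: action_morphismP. Qed.

Lemma mor_compm1 (A B : inv_action) (f : action_morphism A B) :
  mor_comp f (mor_id A) = f.
Proof.
by apply: action_morphismP => // y; rewrite /= /pcomp /=; case: (mor_map f y).
Qed.

Lemma mor_compA (A B C D : inv_action) (h : action_morphism C D)
    (g : action_morphism B C) (f : action_morphism A B) :
  mor_comp h (mor_comp g f) = mor_comp (mor_comp h g) f.
Proof.
by apply: action_morphismP => // y; rewrite /= /pcomp /=; case: (mor_map h y).
Qed.

Theorem theorem3p6 :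
  exists C : @category_on inv_action action_morphism,
    (forall (A1 A2 A3 : inv_action)
        (m2 : action_morphism A2 A3) (m1 : action_morphism A1 A2),
       (mor_sgrp (cat_comp C m2 m1) : act_sgrp A1 -> act_sgrp A3)
         = mor_sgrp m2 \o mor_sgrp m1
       /\ mor_map (cat_comp C m2 m1) = pmap_comp (mor_map m1) (mor_map m2))
    /\ (forall A : inv_action,
       (mor_sgrp (cat_id C A) : act_sgrp A -> act_sgrp A) = id
       /\ mor_map (cat_id C A) = pmap_id (act_space A)).
Proof.
by exists (CategoryOn mor_comp1m mor_compm1 mor_compA).
Qed.
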